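(* Let $f\colon\mathbb{R}^n\to\mathbb{R}\cup\{+\infty\}$, $A\in\mathbb{R}^{m\times n}$, $b\in\mathbb{R}^m$ and $\varepsilon\geq 0$, and let $\mathcal{C} = \{x\in\mathbb{R}^n : \|Ax-b\|\leq\varepsilon\}$. Assume all of the following: (C1) $f$ is closed, convex, and proper; (C2) either $A$ has full row-rank or $\varepsilon>0$; (C3) there is $y\in\mathbb{R}^n$ such that, if $\varepsilon=0$, then $Ay=b$ and, if $\varepsilon>0$, then $\|Ay-b\|<\varepsilon$; (C4) either $f$ is coercive or $\mathcal{C}$ is bounded; (C5) there is $y\in\mathrm{ri}(\mathrm{dom}(f))$ such that, if $\varepsilon=0$, then $Ay=b$ and, if $\varepsilon>0$, then $\|Ay-b\|<\varepsilon$. Let $z^1\in\mathbb{R}^n$ and $\alpha>0$, and let the sequences $\{x^k\}_{k\ge 1}$ and $\{z^k\}_{k\ge 1}$ be generated by $$x^k = \begin{cases} z^k & \text{if } \|Az^k-b\|\leq\varepsilon,\\ z^k - A^\top(AA^\top+\varepsilon\tau_{z^k}\mathrm{I})^{-1}(Az^k-b) & \text{otherwise,}\end{cases}$$ $$z^{k+1} = z^k + \mathrm{prox}_{\alpha f}(2x^k - z^k) - x^k,$$ where, whenever $\|Az^k-b\|>\varepsilon$, $\tau_{z^k}$ is the unique positive solution $\tau$ of $1=\tau\,\|(AA^\top+\varepsilon\tau\mathrm{I})^{-1}(Az^k-b)\|$. Then the sequences $\{x^k\}$ and $\{z^k\}$ converge, with $\{x^k\}$ converging to a solution of the problem $$\min_{x\in\mathbb{R}^n}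 f(x)\quad\text{s.t.}\quad \|Ax-b\|\leq\varepsilon.$$ Moreover, $\|Ax^k-b\|\leq\varepsilon$ for all $k$.
   Context: $\|\cdot\|$ is the Euclidean norm, $\mathrm{I}$ is the identity matrix, $\mathrm{dom}(f)=\{x : f(x)<+\infty\}$, and $\mathrm{ri}$ denotes relative interior. For $\alpha>0$ the proximal operator is $\mathrm{prox}_{\alpha f}(x) = \operatorname{argmin}_{u\in\mathbb{R}^n}\ \alpha f(u)+\tfrac12\|u-x\|^2$, which exists and is unique for $f$ closed, convex, proper. A function $f$ is coercive if $f(x)\to+\infty$ as $\|x\|\to\infty$. *)

(* Defs.v *)
(* R^n is 'cV[R]_n over R : realType. The topology that the
   library puts on 'cV[R]_n comes from the sup norm; it is the Euclidean one,
   but `|x| is not the Euclidean norm, whence [enorm]. *)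
From HB Require Import structures.
From mathcomp Require Export all_boot all_order all_algebra.
From mathcomp Require Export all_classical all_reals all_analysis.
Export numFieldNormedType.Exports.

Set Implicit Arguments.
Unset Strict Implicit.
Unset Printing Implicit Defensive.

Import Order.TTheory GRing.Theory Num.Theory.

Local Open Scope classical_set_scope.
Local Open Scope ring_scope.

Definition enorm (R : realType) (n : nat) (x : 'cV[R]_n) : R :=
  Num.sqrt (\sum_(i < n) x i 0 ^+ 2).

Definition edom (R : realType) (T : Type) (f : T -> \bar R) : set T :=
  [set x | (f x < +oo)%E].

(* The first conjunct is what restricts the values to R \cup {+oo}. *)
Definition proper_fun (R : realType) (T : Type) (f : T -> \bar R) : Prop :=
  (forall x, (-oo < f x)%E) /\ edom f !=set0.

Definition closed_fun (R : realType) (n : nat) (f : 'cV[R]_n -> \bar R) : Prop :=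
  closed [set p : 'cV[R]_n * R | (f p.1 <= p.2%:E)%E].

(* At the end points t = 0, 1 the library's convention 0 * +oo = 0 makes the
   inequality trivial. *)
Definition convex_fun (R : realType) (n : nat) (f : 'cV[R]_n -> \bar R) : Prop :=
  forall (x y : 'cV[R]_n) (t : R), 0 <= t <= 1 ->
    (f (t *: x + (1 - t) *: y)%R <= t%:E * f x + (1 - t)%R%:E * f y)%E.

Definition coercive (R : realType) (n : nat) (f : 'cV[R]_n -> \bar R) : Prop :=
  forall M : R, exists r : R, forall x, r < enorm x -> (M%:E < f x)%E.

Definition affine_set (R : realType) (n : nat) (S : set 'cV[R]_n) : Prop :=
  forall x y (t : R), S x -> S y -> S (t *: x + (1 - t) *: y).

Definition affine_hull (R : realType) (n : nat) (S : set 'cV[R]_n) :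
  set 'cV[R]_n := smallest (@affine_set R n) S.

Definition relint (R : realType) (n : nat) (S : set 'cV[R]_n) : set 'cV[R]_n :=
  [set x | S x /\ exists2 e : R, 0 < e &
    forall y, affine_hull S y -> enorm (y - x) < e -> S y].

Definition argmin (R : realType) (T : Type) (S : set T) (F : T -> \bar R) :
  set T := [set u | S u /\ forall v, S v -> (F u <= F v)%E].

(* The default value 0 of [xget] is only reached when there is no minimizer,
   which cannot happen for alpha > 0 and f closed, convex and proper. *)
Definition prox (R : realType) (n : nat) (alpha : R) (f : 'cV[R]_n -> \bar R)
    (x : 'cV[R]_n) : 'cV[R]_n :=
  xget 0 (argmin setT (fun u =>
    (alpha%:E * f u + (2^-1 * enorm (u - x) ^+ 2)%R%:E)%E)).

Definition feasible (R : realType) (m n : nat) (A : 'M[R]_(m, n)) (b : 'cV[R]_m)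
    (eps : R) : set 'cV[R]_n :=
  [set x | enorm (A *m x - b) <= eps].

(* The root is meant for enorm (A *m z - b) > eps only. There it exists and is
   unique as soon as A has full row rank or eps > 0, and A *m y = b (eps = 0) or
   enorm (A *m y - b) < eps (eps > 0) for some y. *)
Definition tau (R : realType) (m n : nat) (A : 'M[R]_(m, n)) (b : 'cV[R]_m)
    (eps : R) (z : 'cV[R]_n) : R :=
  xget 0 [set t : R | 0 < t /\
    1 = t * enorm (invmx (A *m A^T + (eps * t)%:M) *m (A *m z - b))].

Definition xstep (R : realType) (m n : nat) (A : 'M[R]_(m, n)) (b : 'cV[R]_m)
    (eps : R) (z : 'cV[R]_n) : 'cV[R]_n :=
  if enorm (A *m z - b) <= eps then z
  else z - A^T *m (invmx (A *m A^T + (eps * tau A b eps z)%:M)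
                     *m (A *m z - b)).

(* Main.v *)
(* Each step of the iteration pairs the variational inequality of the projection
   onto the feasible set with that of the proximal operator, and adding these
   inequalities for two trajectories gives a firmly nonexpansive map. As soon as
   this map has a fixed point, its iterates are Fejer monotone and converge.

   A fixed point comes from a solution p together with a vector v normal to the
   feasible set at p such that - v is a subgradient of f at p. Both the ball
   constraint and the equality constraint reduce to a separation in the plane of
   the pairs (constraint value, objective value): a Slater point yields a scalar
   multiplier for the ball, while the m equations of A x = b are dropped one at a
   time, the relative interior point making each multiplier finite. *)
Require Import Defs.
From mathcomp Require Import ring lra.

Set Implicit Arguments.
Unset Strict Implicit.
Unset Printing Implicit Defensive.

Import Order.TTheory GRing.Theory Num.Theory.

Local Open Scope classical_set_scope.
Local Open Scope ring_scope.

(** * Euclidean inner product, continuity and compactness in R^n *)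

Definition dot (R : realType) (n : nat) (x y : 'cV[R]_n) : R := (x^T *m y) 0 0.

Section Dot.
Variables (R : realType) (n : nat).
Implicit Types (x y z : 'cV[R]_n) (t : R).

Lemma dotE x y : dot x y = \sum_i x i 0 * y i 0.
Proof. by rewrite /dot mxE; apply: eq_bigr => i _; rewrite mxE. Qed.

Lemma dotC x y : dot x y = dot y x.
Proof. by rewrite !dotE; apply: eq_bigr => i _; rewrite mulrC. Qed.

Lemma dotDl x y z : dot (x + y) z = dot x z + dot y z.
Proof. by rewrite /dot linearD mulmxDl mxE. Qed.

Lemma dotDr x y z : dot z (x + y) = dot z x + dot z y.
Proof. by rewrite /dot mulmxDr mxE. Qed.

Lemma dotNl x y : dot (- x) y = - dot x y.
Proof. by rewrite /dot linearN mulNmx mxE. Qed.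

Lemma dotNr x y : dot x (- y) = - dot x y.
Proof. by rewrite /dot mulmxN mxE. Qed.

Lemma dotZl t x y : dot (t *: x) y = t * dot x y.
Proof. by rewrite /dot linearZ -scalemxAl mxE. Qed.

Lemma dotZr t x y : dot x (t *: y) = t * dot x y.
Proof. by rewrite /dot -scalemxAr mxE. Qed.

Definition dot_lin := (dotDl, dotDr, dotNl, dotNr, dotZl, dotZr).

Lemma dot_ge0 x : 0 <= dot x x.
Proof. by rewrite dotE sumr_ge0 // => i _; rewrite -expr2 sqr_ge0. Qed.

Lemma dot_eq0 x : dot x x = 0 -> x = 0.
Proof.
rewrite dotE => /eqP; rewrite psumr_eq0; last by move=> i _; rewrite -expr2 sqr_ge0.
move=> /allP h; apply/colP => i; rewrite mxE; apply/eqP.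
by have := h i (mem_index_enum i); rewrite mulf_eq0 orbb.
Qed.

Lemma enormE x : enorm x = Num.sqrt (dot x x).
Proof. by rewrite /enorm dotE; congr Num.sqrt; apply: eq_bigr => i _; rewrite expr2. Qed.

Lemma enorm_ge0 x : 0 <= enorm x.
Proof. exact: sqrtr_ge0. Qed.

Lemma enorm_sqr x : enorm x ^+ 2 = dot x x.
Proof. by rewrite enormE sqr_sqrtr // dot_ge0. Qed.

Lemma enorm_le x t : 0 <= t -> (enorm x <= t) = (dot x x <= t ^+ 2).
Proof. by move=> t0; rewrite -enorm_sqr ler_sqr // nnegrE enorm_ge0. Qed.

Lemma enorm_lt x t : 0 <= t -> (enorm x < t) = (dot x x < t ^+ 2).
Proof. by move=> t0; rewrite -enorm_sqr ltr_sqr // nnegrE enorm_ge0. Qed.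

Lemma enorm_eq x t : 0 <= t -> dot x x = t ^+ 2 -> enorm x = t.
Proof. by move=> t0 h; rewrite enormE h sqrtr_sqr ger0_norm. Qed.

Lemma enormZ t x : enorm (t *: x) = `|t| * enorm x.
Proof.
apply: enorm_eq; rewrite ?mulr_ge0 ?enorm_ge0 // !dot_lin exprMn enorm_sqr.
by rewrite real_normK ?num_real //; ring.
Qed.

Lemma enorm0 : enorm (0 : 'cV[R]_n) = 0.
Proof. by rewrite -(scale0r 0) enormZ normr0 mul0r. Qed.

Lemma enormN x : enorm (- x) = enorm x.
Proof. by rewrite -scaleN1r enormZ normrN1 mul1r. Qed.

Lemma dot_cauchy x y : dot x y <= enorm x * enorm y.
Proof.
have [y0|y0] := eqVneq (enorm y) 0.
  have -> : y = 0 by apply: dot_eq0; rewrite -enorm_sqr y0 expr0n.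
  by rewrite -(scale0r (0 : 'cV[R]_n)) dotZr mul0r mulr_ge0 // enorm_ge0.
have {}y0 : 0 < enorm y by rewrite lt_neqAle eq_sym y0 enorm_ge0.
have [x0|x0] := eqVneq (enorm x) 0.
  have -> : x = 0 by apply: dot_eq0; rewrite -enorm_sqr x0 expr0n.
  by rewrite -(scale0r (0 : 'cV[R]_n)) dotZl mul0r mulr_ge0 // enorm_ge0.
have {}x0 : 0 < enorm x by rewrite lt_neqAle eq_sym x0 enorm_ge0.
(* With a, b the norms and c the inner product, this square expands to 2ab(ab - c), and 2ab > 0. *)
have := dot_ge0 (enorm y *: x - enorm x *: y).
rewrite !dot_lin (dotC y x) -!enorm_sqr.
set a := enorm x in x0 *; set b := enorm y in y0 *; set c := dot x y.
have ab : 0 < 2 * (a * b) by rewrite !mulr_gt0.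
move=> h; rewrite -subr_ge0 -(pmulr_rge0 _ ab).
by apply: le_trans h _; rewrite le_eqVlt; apply/orP; left; apply/eqP; ring.
Qed.

Lemma coord_le_enorm x i : `|x i 0| <= enorm x.
Proof.
rewrite -ler_sqr ?nnegrE ?enorm_ge0 // real_normK ?num_real // enorm_sqr dotE.
rewrite (bigD1 i) //= expr2 lerDl sumr_ge0 // => j _.
by rewrite -expr2 sqr_ge0.
Qed.

Lemma norm_le_enorm x : `|x| <= enorm x.
Proof.
rewrite [leLHS]/Num.Def.normr /= mx_normrE; apply: bigmax_le; first exact: enorm_ge0.
by move=> [i j] _ /=; rewrite (ord1 j) coord_le_enorm.
Qed.

Lemma dot_convex x y t : 0 <= t <= 1 ->
  dot (t *: x + (1 - t) *: y) (t *: x + (1 - t) *: y) <=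
  t * dot x x + (1 - t) * dot y y.
Proof.
move=> /andP[t0 t1]; have tt : 0 <= t * (1 - t) by rewrite mulr_ge0 ?subr_ge0.
have := mulr_ge0 tt (dot_ge0 (x - y)); rewrite !dot_lin (dotC y x); lra.
Qed.

Lemma dot_continuous (T : topologicalType) (u v : T -> 'cV[R]_n) :
  continuous u -> continuous v -> continuous (fun p => dot (u p) (v p)).
Proof.
move=> cu cv p.
have -> : (fun p => dot (u p) (v p)) = (fun p => \sum_i (u p i 0 * v p i 0)).
  by apply/funext => q; rewrite dotE.
apply: cvg_big => [|i _]; first exact: add_continuous.
apply: cvgM.
  apply: (@continuous_comp _ _ _ u (fun M : 'cV[R]_n => M i 0)); first exact: cu.
  exact: coord_continuous.
apply: (@continuous_comp _ _ _ v (fun M : 'cV[R]_n => M i 0)); first exact: cv.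
exact: coord_continuous.
Qed.
End Dot.

Lemma dot_mull (R : realType) (m n : nat) (A : 'M[R]_(m, n)) x y :
  dot (A *m x) y = dot x (A^T *m y).
Proof. by rewrite /dot trmx_mul mulmxA. Qed.

Lemma affine_comb (R : realType) (m n : nat) (A : 'M[R]_(m, n)) (b : 'cV[R]_m) u v t :
  A *m (t *: u + (1 - t) *: v) - b = t *: (A *m u - b) + (1 - t) *: (A *m v - b).
Proof.
by rewrite mulmxDr -!scalemxAr !scalerBr; apply/colP => i; rewrite !mxE; ring.
Qed.

Lemma mx_continuous (R : realType) (T : topologicalType) (m n : nat)
    (u : T -> 'M[R]_(m, n)) :
  (forall i j, continuous (fun p => u p i j)) -> continuous u.
Proof.
move=> cu p; apply/cvg_ballP => e e0.
have : \forall q \near p, forall ij : 'I_m * 'I_n, ball (u p ij.1 ij.2) e (u q ij.1 ij.2).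
  by apply: filter_forall => -[i j]; exact: (cvg_ball (cu i j p)).
by apply: filterS => q h; split => // i j; exact: (h (i, j)).
Qed.

Lemma affine_continuous (R : realType) (m n : nat) (A : 'M[R]_(m, n)) (b : 'cV[R]_m) :
  continuous (fun x : 'cV[R]_n => A *m x - b).
Proof.
apply: mx_continuous => i j x.
have -> : (fun y : 'cV[R]_n => (A *m y - b) i j) =
          (fun y => dot (row i A)^T y - b i j).
  apply/funext => y; rewrite dotE !mxE (ord1 j); congr (_ - _).
  by apply: eq_bigr => k _; rewrite !mxE.
have cd : continuous (fun y => dot (row i A)^T y).
  by apply: dot_continuous => y; [exact: cst_continuous|apply: cvg_id].
by apply: (cvgB (cd x)); exact: cvg_cst.
Qed.

Lemma enorm_continuous (R : realType) (n : nat) : continuous (@enorm R n).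
Proof.
move=> x; have -> : @enorm R n = Num.sqrt \o (fun y => dot y y).
  by apply/funext => y; rewrite enormE.
apply: continuous_comp; first by apply: dot_continuous => y; by apply: cvg_id.
exact: sqrt_continuous.
Qed.

(** Heine-Borel for row vectors, carried to columns by transposition, which is continuous and
    preserves the sup norm. *)
Lemma bounded_closed_compact_cV (R : realType) (n : nat) (S : set 'cV[R]_n) (r : R) :
  closed S -> (forall x, S x -> `|x| <= r) -> compact S.
Proof.
move=> cS bS.
have ctr : forall p q, continuous (@trmx R p q).
  move=> p q; apply: mx_continuous => i j M.
  have -> : (fun N : 'M[R]_(p, q) => N^T i j) = (fun N => N j i).
    by apply/funext => N; rewrite mxE.
  exact: coord_continuous.
have -> : S = [set x^T | x in [set x : 'rV[R]_n | S x^T]].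
  apply/seteqP; split=> [x Sx|_ [x Sx <-] //].
  by exists x^T; rewrite /= trmxK.
apply: continuous_compact; first by apply: continuous_subspaceT; exact: ctr.
apply: bounded_closed_compact; last first.
  by apply: (preimage_closed _ cS) => x _; exact: ctr.
exists r; split; first exact: num_real.
move=> M rM x /= Sx; apply: le_trans (ltW rM).
have -> : `|x| = `|x^T|.
  rewrite /Num.Def.normr /= !mx_normrE; apply/le_anti/andP; split.
    apply: bigmax_le; first by apply: bigmax_ge_id.
    by move=> [i j] _; apply: le_trans (le_bigmax _ _ (j, i)); rewrite mxE.
  apply: bigmax_le; first by apply: bigmax_ge_id.
  by move=> [i j] _; apply: le_trans (le_bigmax _ _ (j, i)); rewrite mxE.
exact: bS.
Qed.

(** * Closed functions and existence of minimizers *)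

Lemma pair_continuous (T U V : topologicalType) (f : T -> U) (g : T -> V) :
  continuous f -> continuous g -> continuous (fun p => (f p, g p)).
Proof.
move=> cf cg p.
apply: (cvg_pair (F := nbhs p) (G := nbhs (f p)) (H := nbhs (g p))).
  exact: cf.
exact: cg.
Qed.

Lemma sublevel_closed (R : realType) (n : nat) (F : 'cV[R]_n -> \bar R) (c : R) :
  closed_fun F -> closed [set x | (F x <= c%:E)%E].
Proof.
move=> cF.
pose h (x : 'cV[R]_n) := (x, c).
apply: (@preimage_closed _ _ h [set p | (F p.1 <= p.2%:E)%E] _ cF) => x _.
by apply: (@pair_continuous _ _ _ id (cst c)) => y; [exact: cvg_id|exact: cst_continuous].
Qed.

(** The sets [B v] are closed and totally ordered by inclusion, so they generate a proper filter.
    Since [B x0] is compact, this filter has a cluster point, which lies in every closed [B v] with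
    [F v] finite and hence minimizes. *)
Lemma argmin_nonempty (R : realType) (n : nat) (F : 'cV[R]_n -> \bar R)
    (S : set 'cV[R]_n) (x0 : 'cV[R]_n) (r : R) :
  closed_fun F -> (forall x, (-oo < F x)%E) -> closed S -> S x0 ->
  (F x0 < +oo)%E -> (forall x, S x -> (F x <= F x0)%E -> `|x| <= r) ->
  argmin S F !=set0.
Proof.
move=> cF gtF cS Sx0 Fx0 bF.
pose B v := [set x | S x /\ (F x <= F v)%E].
have Bcl v : (F v < +oo)%E -> closed (B v).
  move=> Fv; apply: closedI => //.
  have /fineK <- : F v \is a fin_num by rewrite fin_numElt gtF.
  exact: sublevel_closed.
pose G := filter_from (B x0) B.
have GF : ProperFilter G.
  apply: filter_from_proper; last by move=> v [Sv _]; exists v; split.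
  apply: filter_from_filter; first by exists x0; split.
  move=> u v Bu Bv; have [uv|/ltW vu] := leP (F u) (F v).
    by exists u => // x [Sx xu]; split; split => //; exact: le_trans uv.
  by exists v => // x [Sx xv]; split; split => //; exact: le_trans vu.
have Kc : compact (B x0).
  by apply: (@bounded_closed_compact_cV _ _ _ r (Bcl _ Fx0)) => x [Sx]; exact: bF.
have [p [[Sp pF] clp]] : (B x0 `&` cluster G) !=set0.
  by apply: Kc; exists x0 => //; split.
exists p; split => // v Sv.
have [vF|/ltW] := leP (F v) (F x0); last exact: le_trans.
have : B v p; last by case.
apply: Bcl; first exact: le_lt_trans vF Fx0.
by move=> U pU; apply: clp => //; exists v.
Qed.

Lemma closed_fun_addr (R : realType) (n : nat) (f : 'cV[R]_n -> \bar R)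
    (alpha : R) (q : 'cV[R]_n -> R) :
  0 < alpha -> closed_fun f -> continuous q ->
  closed_fun (fun u => (alpha%:E * f u + (q u)%:E)%E).
Proof.
move=> a0 cf cq.
(* The epigraph of the sum is the preimage under this continuous map of the epigraph of [f]. *)
pose h (p : 'cV[R]_n * R) := (p.1, (p.2 - q p.1) / alpha).
rewrite /closed_fun /=.
have -> : [set p : 'cV[R]_n * R | (alpha%:E * f p.1 + (q p.1)%:E <= p.2%:E)%E] =
   h @^-1` [set p | (f p.1 <= p.2%:E)%E].
  apply/seteqP; split=> -[u t] /=; case: (f u) => [r| |] //=.
  - by rewrite !lee_fin ler_pdivlMr // => ?; lra.
  - by rewrite gt0_muley // lte_fin.
  - by rewrite leNye.
  - by rewrite !lee_fin ler_pdivlMr // => ?; lra.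
  - by move=> _; rewrite gt0_muleNy ?lte_fin // addNye leNye.
apply: (@preimage_closed _ _ h [set p | (f p.1 <= p.2%:E)%E] _ cf) => -[u t] _.
apply: (@pair_continuous _ _ _ fst (fun p => (p.2 - q p.1) / alpha)) => {u t} -[u t].
  exact: cvg_fst.
apply: cvgM; last exact: cvg_cst.
apply: cvgB; first exact: cvg_snd.
by apply: (@continuous_comp _ _ _ fst q); [exact: cvg_fst|exact: cq].
Qed.

(** * Real-valued convexity and first-order optimality *)

(** Convexity of [D] is built in; pairing [edom f] with [fine \o f] keeps all later inequalities in
    the reals. *)
Definition convex_on (R : realType) (n : nat) (D : set 'cV[R]_n)
    (F : 'cV[R]_n -> R) : Prop :=
  forall x y t, D x -> D y -> 0 <= t <= 1 ->
    D (t *: x + (1 - t) *: y) /\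
    F (t *: x + (1 - t) *: y) <= t * F x + (1 - t) * F y.

Lemma edom_fineK (R : realType) (n : nat) (f : 'cV[R]_n -> \bar R) x :
  proper_fun f -> edom f x -> ((fine (f x))%:E)%E = f x.
Proof. by move=> [gtf _] fx; apply: fineK; rewrite fin_numElt gtf. Qed.

Lemma convex_on_fine (R : realType) (n : nat) (f : 'cV[R]_n -> \bar R) :
  proper_fun f -> convex_fun f -> convex_on (edom f) (fine \o f).
Proof.
move=> pf cf x y t Dx Dy t01.
have := cf x y t t01.
rewrite -(edom_fineK pf Dx) -(edom_fineK pf Dy) -!EFinM -EFinD => h.
have Dz : edom f (t *: x + (1 - t) *: y) by exact: le_lt_trans h (ltry _).
by split=> //; move: h; rewrite -(edom_fineK pf Dz) lee_fin.
Qed.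

Lemma slope_ge0 (R : realType) (a b : R) :
  (forall t, 0 < t -> t <= 1 -> 0 <= t * a + t ^+ 2 * b) -> 0 <= a.
Proof.
move=> h; rewrite leNgt; apply/negP => a0.
have d0 : 0 < `|b| - a + 1 by have := normr_ge0 b; lra.
(* If a < 0, this t lies in (0, 1] and satisfies t|b| < -a, so a + tb < 0. *)
pose t := - a / (`|b| - a + 1).
have t0 : 0 < t by rewrite divr_gt0 //; lra.
have := h t t0; rewrite ler_pdivrMr // => /(_ _)/wrap[]; first by have := normr_ge0 b; lra.
have -> : t * a + t ^+ 2 * b = t * (a + t * b) by ring.
rewrite pmulr_rge0 // leNgt => /negP; apply.
have tb : t * b <= t * `|b| by rewrite ler_pM2l // ler_norm.
have : t * `|b| < - a.
  by rewrite /t -mulrA gtr_pMr ?oppr_gt0 // mulrC ltr_pdivrMr //; lra.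
lra.
Qed.

(** Comparing [p] with the points at parameter t on the segment towards [u] gives an inequality
    without constant term in t; its linear coefficient is the conclusion. [B] is the identity for
    the proximal and projection problems, and [A] for the ball constraint. *)
Lemma fermat_quadratic (R : realType) (m n : nat) (B : 'M[R]_(m, n)) (w : 'cV[R]_m)
    (D : set 'cV[R]_n) (F : 'cV[R]_n -> R) (c : R) (p u : 'cV[R]_n) :
  convex_on D F -> D p -> D u ->
  (forall v, D v -> F p + c * dot (B *m p - w) (B *m p - w) <=
                    F v + c * dot (B *m v - w) (B *m v - w)) ->
  0 <= F u - F p + 2 * c * dot (B *m p - w) (B *m (u - p)).
Proof.
move=> cF Dp Du minp.
apply: (@slope_ge0 _ _ (c * dot (B *m (u - p)) (B *m (u - p)))) => t t0 t1.
have [Dt Ft] := cF u p t Du Dp (introT andP (conj (ltW t0) t1)).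
have := minp _ Dt.
have -> : B *m (t *: u + (1 - t) *: p) - w = (B *m p - w) + t *: (B *m (u - p)).
  rewrite mulmxDr mulmxBr -!scalemxAr scalerBr scalerBl scale1r.
  by rewrite addrC addrCA !addrA; apply/colP => i; rewrite !mxE; ring.
move: (B *m p - w) (B *m (u - p)) => r d.
rewrite !dot_lin (dotC d r) => h.
move: Ft h; set F1 := F (_ + _) => Ft h; nra.
Qed.

(** * The feasible set is closed; the proximal operator *)

Lemma enormB_continuous (R : realType) (m n : nat) (A : 'M[R]_(m, n)) (b : 'cV[R]_m) :
  continuous (fun x => enorm (A *m x - b)).
Proof.
move=> x; apply: (@continuous_comp _ _ _ (fun x => A *m x - b) (@enorm R m)).
  exact: affine_continuous.
exact: enorm_continuous.
Qed.

Lemma feasible_closed (R : realType) (m n : nat) (A : 'M[R]_(m, n)) (b : 'cV[R]_m) (r : R) :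
  closed (feasible A b r).
Proof.
apply: (@preimage_closed _ _ (fun x => enorm (A *m x - b)) [set t | t <= r]).
  by move=> x _; exact: enormB_continuous.
exact: closed_le.
Qed.

Lemma closed_fun_prox (R : realType) (n : nat) (f : 'cV[R]_n -> \bar R) (alpha : R)
    (x : 'cV[R]_n) : 0 < alpha -> closed_fun f ->
  closed_fun (fun u => (alpha%:E * f u + (2^-1 * enorm (u - x) ^+ 2)%R%:E)%E).
Proof.
move=> a0 cf; apply: closed_fun_addr => //.
have -> : (fun u => 2^-1 * enorm (u - x) ^+ 2) =
          (fun u => 2^-1 * dot (1%:M *m u - x) (1%:M *m u - x)).
  by apply/funext => u; rewrite mul1mx enorm_sqr.
have cd : continuous (fun u : 'cV[R]_n => dot (1%:M *m u - x) (1%:M *m u - x)).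
  by apply: dot_continuous; exact: affine_continuous.
by move=> u; apply: (cvgM _ (cd u)); exact: cvg_cst.
Qed.

(* Convexity turns the lower bound of [f] on a unit ball into a linear lower
   bound outside of it, which the quadratic term of [prox] dominates. *)
Lemma prox_argmin (R : realType) (n : nat) (f : 'cV[R]_n -> \bar R) (alpha : R)
    (x : 'cV[R]_n) : 0 < alpha -> closed_fun f -> convex_fun f -> proper_fun f ->
  argmin setT (fun u => (alpha%:E * f u + (2^-1 * enorm (u - x) ^+ 2)%R%:E)%E)
    (prox alpha f x).
Proof.
move=> a0 cf vf pf; apply: xgetPex; have [gtf [x0 Dx0]] := pf.
have F x1 := edom_fineK pf (x := x1).
have [y [By miny]] : argmin (feasible 1%:M x0 1) f !=set0.
  apply: (@argmin_nonempty _ _ _ _ x0 (1 + `|x0|)) => //.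
  - exact: feasible_closed.
  - by rewrite /feasible /= mul1mx subrr enorm0.
  - move=> v; rewrite /feasible /= mul1mx => vB _.
    rewrite -[v](subrK x0); apply: le_trans (ler_normD _ _) _.
    by rewrite lerD2r; apply: le_trans vB; exact: norm_le_enorm.
have yx0 : (f y <= f x0)%E.
  by apply: miny; rewrite /feasible /= mul1mx subrr enorm0.
have Dy : edom f y by exact: le_lt_trans yx0 _.
pose K := fine (f x0) - fine (f y).
have K0 : 0 <= K by rewrite subr_ge0 -lee_fin !F.
pose d := enorm (x0 - x).
have d0 : 0 <= d := enorm_ge0 _.
have aK : 0 <= alpha * K by rewrite mulr_ge0 // ltW.
(* For r = |p - x0| > 1, the bound f(p) >= f(x0) - rK and |p - x|^2 >= r^2 - 2rd + d^2 leave r^2 / 2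
   <= r(alpha K + d), whence this radius. *)
apply: (@argmin_nonempty _ _ _ _ x0 (1 + 2 * (alpha * K + d) + `|x0|)) => //.
- exact: closed_fun_prox.
- move=> u; have := gtf u; case: (f u) => [r| |] // _; first by rewrite -EFinM -EFinD ltNyr.
  by rewrite gt0_muley ?lte_fin.
- by rewrite -F // -EFinM -EFinD ltry.
move=> p _ pF.
have Dp : edom f p.
  rewrite /edom /= ltey; apply/eqP => fp; move: pF.
  by rewrite fp gt0_muley ?lte_fin // -(F x0) // -EFinM -EFinD addye // leNgt ltry.
rewrite -[p in `|p|](subrK x0); apply: le_trans (ler_normD _ _) _.
rewrite lerD2r; apply: le_trans (norm_le_enorm _) _.
set r := enorm (p - x0).
have [r1|r1] := leP r 1; first by lra.
have r0 : 0 < r by lra.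
have low : fine (f x0) - r * K <= fine (f p).
  have t01 : 0 <= r^-1 <= 1 by rewrite invr_ge0 ltW //= invf_le1 // ltW.
  have [Dz Fz] := convex_on_fine pf vf Dp Dx0 t01.
  have : fine (f y) <= fine (f (r^-1 *: p + (1 - r^-1) *: x0)).
    rewrite -lee_fin !F //; apply: miny; rewrite /feasible /= mul1mx.
    have -> : r^-1 *: p + (1 - r^-1) *: x0 - x0 = r^-1 *: (p - x0).
      by apply/colP => i; rewrite !mxE; ring.
    by rewrite enormZ ger0_norm ?invr_ge0 ?(ltW r0) // -/r mulVf // gt_eqF.
  move=> /le_trans /(_ Fz); rewrite -(ler_pM2l r0) /=.
  have -> : r * (r^-1 * fine (f p) + (1 - r^-1) * fine (f x0)) =
    fine (f p) + r * fine (f x0) - fine (f x0).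
    by rewrite mulrDr mulrA mulfV ?gt_eqF // mul1r mulrA mulrBr mulr1 mulfV ?gt_eqF //; ring.
  by rewrite /K; lra.
move: pF; rewrite -(F _ Dp) -(F _ Dx0) -!EFinM -!EFinD lee_fin.
have -> : p - x = (p - x0) + (x0 - x) by rewrite addrA subrK.
have := dot_cauchy (p - x0) (- (x0 - x)).
rewrite enormN dotNr -/r -/d !enorm_sqr.
have : dot (p - x0) (p - x0) = r ^+ 2 by rewrite enorm_sqr.
move: (p - x0) (x0 - x) => v w rr cs.
rewrite !dot_lin (dotC w v) rr => pF.
have : alpha * (fine (f x0) - r * K) <= alpha * fine (f p) by rewrite ler_pM2l.
move: pF cs; move: (fine (f p)) (fine (f x0)) (dot _ _) (dot _ _) => fp f0 vw ww.
move=> h1 h2 h3; suff : r <= 2 * (alpha * K + d) by lra.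
rewrite -(ler_pM2l r0).
have -> : r * (2 * (alpha * K + d)) = 2 * (alpha * (r * K) + r * d) by ring.
by move: h3; rewrite mulrBr -expr2; lra.
Qed.

(** The inequality states that [x - prox alpha f x] is a subgradient of [alpha f] at the proximal
    point. It is the first-order condition of the defining minimization. *)
Lemma prox_spec (R : realType) (n : nat) (f : 'cV[R]_n -> \bar R) (alpha : R)
    (x : 'cV[R]_n) : 0 < alpha -> closed_fun f -> convex_fun f -> proper_fun f ->
  edom f (prox alpha f x) /\
  forall u, edom f u ->
    alpha * fine (f (prox alpha f x)) + dot (x - prox alpha f x) (u - prox alpha f x)
      <= alpha * fine (f u).
Proof.
move=> a0 cf vf pf; have [_] := prox_argmin x a0 cf vf pf.
set p := prox alpha f x => minp; have [gtf [x0 Dx0]] := pf.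
have F x1 := edom_fineK pf (x := x1).
have Dp : edom f p.
  rewrite /edom /= ltey; apply/eqP => fp; move: (minp x0 I).
  by rewrite fp gt0_muley ?lte_fin // -(F x0) // -EFinM -EFinD addye // leNgt ltry.
split=> // u Du.
have caf : convex_on (edom f) (fun v => alpha * fine (f v)).
  move=> v w t Dv Dw t01; have [Dz Fz] := convex_on_fine pf vf Dv Dw t01.
  split=> //; rewrite -(ler_pM2l a0) /= in Fz.
  by apply: le_trans Fz _; rewrite le_eqVlt; apply/orP; left; apply/eqP; ring.
have := @fermat_quadratic _ _ _ 1%:M x _ _ 2^-1 p u caf Dp Du.
rewrite !mul1mx mulfV ?pnatr_eq0 // mul1r => /(_ _)/wrap[].
  move=> v Dv; have := minp v I.
  by rewrite -(F _ Dv) -(F _ Dp) -!EFinM -!EFinD lee_fin !enorm_sqr !mul1mx.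
rewrite -[p - x]opprB dotNl; lra.
Qed.

(** * Lagrange multipliers for the ball and for affine constraints *)

(** The multiplier is the supremum of -t/s over the points with s > 0. Each point with s < 0 bounds
    it from above, since a segment joining the two sides meets the axis s = 0 where t >= 0. Points
    on both sides make the supremum finite. *)
Lemma scalar_multiplier (R : realType) (E : R -> R -> Prop) :
  (forall s t s' t' a, E s t -> E s' t' -> 0 <= a <= 1 ->
     E (a * s + (1 - a) * s') (a * t + (1 - a) * t')) ->
  (forall t, E 0 t -> 0 <= t) ->
  (exists s t, E s t /\ s < 0) -> (exists s t, E s t /\ 0 < s) ->
  exists l, forall s t, E s t -> 0 <= t + l * s.
Proof.
move=> cE E0 [s1 [t1 [E1 s1n]]] [s2 [t2 [E2 s2p]]].
pose A := [set r : R | exists s t, [/\ E s t, 0 < s & r = - t / s]].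
have ubA s t : E s t -> s < 0 -> ubound A (- t / s).
  move=> Est sn _ [s' [t' [Est' sp ->]]].
  (* The weight at which the segment crosses s = 0. *)
  pose a := - s / (s' - s).
  have ss : 0 < s' - s by lra.
  have a01 : 0 <= a <= 1.
    by rewrite /a divr_ge0 ?(ltW ss) ?oppr_ge0 ?(ltW sn) //= ler_pdivrMr //; lra.
  have := cE _ _ _ _ _ Est' Est a01.
  have aE : a * (s' - s) = - s by rewrite /a divfK // gt_eqF.
  have -> : a * s' + (1 - a) * s = 0 by move: aE; lra.
  move=> /E0; rewrite -(pmulr_lge0 _ ss).
  have -> : (a * t' + (1 - a) * t) * (s' - s) = a * (s' - s) * (t' - t) + t * (s' - s) by ring.
  rewrite aE => h.
  rewrite ler_pdivrMr // mulrAC -[_ / s]opprK -mulrN -invrN.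
  by rewrite -mulNr ler_pdivlMr ?oppr_gt0 //; lra.
have A0 : A !=set0 by exists (- t2 / s2), s2, t2.
have hA : has_sup A by split=> //; exists (- t1 / s1); exact: ubA.
exists (sup A) => s t Est; have [sn|sp|s0] := ltrgt0P s.
- have : - t / s <= sup A by apply: ub_le_sup; [exact: hA.2|exists s, t].
  by rewrite ler_pdivrMr //; lra.
- have : sup A <= - t / s by apply: ge_sup => //; exact: ubA.
  by rewrite ler_ndivlMr //; lra.
- by move: Est; rewrite s0 mulr0 addr0; exact: E0.
Qed.

(** [E] collects the pairs lying above some (g(u), F(u) - F(p)): it is convex, and the Slater point
    puts a pair at s < 0. The scalar multiplier makes [p] a minimizer of F + l g over [D], and the
    first-order condition of that problem is the conclusion. *)
Lemma kkt_ball (R : realType) (m n : nat) (A : 'M[R]_(m, n)) (b : 'cV[R]_m) (eps : R)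
    (D : set 'cV[R]_n) (F : 'cV[R]_n -> R) (y p : 'cV[R]_n) :
  0 < eps -> convex_on D F -> D y -> enorm (A *m y - b) < eps ->
  D p -> enorm (A *m p - b) <= eps ->
  (forall u, D u -> enorm (A *m u - b) <= eps -> F p <= F u) ->
  exists l, [/\ 0 <= l, l * (dot (A *m p - b) (A *m p - b) - eps ^+ 2) = 0 &
    forall u, D u -> 0 <= F u - F p + 2 * l * dot (A *m p - b) (A *m (u - p))].
Proof.
move=> e0 cF Dy ye Dp; rewrite (enorm_le _ (ltW e0)) => pe minp.
rewrite (enorm_lt _ (ltW e0)) in ye.
pose g u := dot (A *m u - b) (A *m u - b) - eps ^+ 2.
pose E s t := exists u, [/\ D u, g u <= s & F u - F p <= t].
have cg u v t : 0 <= t <= 1 -> g (t *: u + (1 - t) *: v) <= t * g u + (1 - t) * g v.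
  move=> t01; rewrite /g affine_comb.
  by have := dot_convex (A *m u - b) (A *m v - b) t01; lra.
have [||||l hl] := @scalar_multiplier _ E.
- move=> s t s' t' a [u [Du gu Fu]] [v [Dv gv Fv]] a01.
  have [Dz Fz] := cF _ _ _ Du Dv a01; have gz := cg u v a a01.
  have /andP[a0 a1] := a01; exists (a *: u + (1 - a) *: v); split => //.
    apply: le_trans gz _; apply: lerD; apply: ler_wpM2l => //; lra.
  have : a * (F u - F p) + (1 - a) * (F v - F p) <= a * t + (1 - a) * t'.
    by apply: lerD; apply: ler_wpM2l => //; lra.
  lra.
- move=> t [u [Du gu Fu]]; apply: le_trans Fu; rewrite subr_ge0 minp //.
  by rewrite (enorm_le _ (ltW e0)) -subr_le0.
- exists (g y), (F y - F p); split; first by exists y.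
  by rewrite subr_lt0.
- exists 1, 0; split => //; exists p; split=> //; last by rewrite subrr.
  by apply: le_trans (_ : 0 <= _) => //; rewrite subr_le0.
(* As [E] is upward closed, l < 0 would put (-1/l, 0) in it, giving 0 <= -1. *)
have l0 : 0 <= l.
  rewrite leNgt; apply/negP => l0.
  have /hl : E (- l^-1) 0.
    exists p; split=> //; last by rewrite subrr.
    by apply: le_trans (_ : 0 <= _); rewrite ?subr_le0 // oppr_ge0 invr_le0 ltW.
  by rewrite add0r mulrN mulfV ?lt_eqF // oppr_ge0 ler10.
have lg : l * g p = 0.
  apply/le_anti/andP; split; first by rewrite mulr_ge0_le0 // subr_le0.
  have /hl : E (g p) 0 by exists p; split => //; rewrite subrr.
  by rewrite add0r.
exists l; split=> // u Du; apply: (fermat_quadratic cF Dp Du) => v Dv.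
have /hl : E (g v) (F v - F p) by exists v.
by move: lg; rewrite /g; lra.
Qed.

Lemma reflection_comb (R : realType) (n : nat) (x y : 'cV[R]_n) (d : R) :
  y + d *: (y - x) = (1 + d) *: y + (1 - (1 + d)) *: x.
Proof. by apply/colP => i; rewrite !mxE; ring. Qed.

(** The hypothesis on [d] says that every segment of [D] ending at [y] can be prolonged beyond [y].
    Hence each constraint value is either identically 0 on the remaining set or takes both signs
    there, which is what [scalar_multiplier] requires. *)
Lemma affine_multiplier (R : realType) (m n : nat) (A : 'M[R]_(m, n)) (b : 'cV[R]_m)
    (D : set 'cV[R]_n) (F : 'cV[R]_n -> R) (y : 'cV[R]_n) (c : R) :
  convex_on D F -> D y -> A *m y = b ->
  (forall x, D x -> exists2 d, 0 < d & D (y + d *: (y - x))) ->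
  (forall x, D x -> A *m x = b -> c <= F x) ->
  exists w, forall x, D x -> c <= F x + dot w (A *m x - b).
Proof.
move=> cF Dy Ayb riy minc.
(* Here j counts the dropped equations, the last ones first: only those of index below m - j are
   still imposed. *)
suff H j : (j <= m)%N -> exists w, forall x, D x ->
    (forall i : 'I_m, (i < m - j)%N -> (A *m x - b) i 0 = 0) ->
    c <= F x + dot w (A *m x - b).
  have [w hw] := H m (leqnn m); exists w => x Dx; apply: hw => // i.
  by rewrite subnn.
elim: j => [_|j IH jm].
  exists 0 => x Dx h; rewrite dotE big1 ?addr0 => [|i _]; last by rewrite mxE mul0r.
  apply: minc => //; apply/subr0_eq/colP => i; rewrite h ?mxE //.
  by rewrite subn0.
have [w hw] := IH (ltnW jm).
have km : (m - j.+1 < m)%N by rewrite ltn_subrL; case: m jm {A b Ayb minc IH w hw}.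
pose k := Ordinal km.
have kj : (m - j = k.+1)%N by rewrite /= subnSK.
pose V x := forall i : 'I_m, (i < k)%N -> (A *m x - b) i 0 = 0.
have hk x : D x -> V x -> (A *m x - b) k 0 = 0 -> c <= F x + dot w (A *m x - b).
  move=> Dx Vx xk; apply: hw => // i; rewrite kj ltnS leq_eqVlt => /orP[/eqP ik|]; last exact: Vx.
  by have -> : i = k by exact: val_inj.
have Vcomb u v t : V u -> V v -> V (t *: u + (1 - t) *: v).
  move=> Vu Vv i ik; rewrite affine_comb !mxE.
  by move: (Vu i ik) (Vv i ik); rewrite !mxE => -> ->; rewrite !mulr0 addr0.
have Vy : V y by move=> i _; rewrite Ayb subrr mxE.
have refl x : D x -> V x -> exists2 d, 0 < d &
    exists x', [/\ D x', V x' & (A *m x' - b) k 0 = - d * (A *m x - b) k 0].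
  move=> Dx Vx; have [d d0 Dd] := riy x Dx; exists d => //.
  exists (y + d *: (y - x)); rewrite [in V _]reflection_comb [in A *m _]reflection_comb.
  split=> //; first exact: Vcomb.
  rewrite affine_comb Ayb subrr scaler0 add0r !mxE; ring.
(* If equation [k] holds on the whole remaining set, the previous multiplier still works. *)
have [allk|] := pselect (forall x, D x -> V x -> (A *m x - b) k 0 = 0).
  by exists w => x Dx Vx; apply: hk => //; exact: allk.
move=> /existsNP[x1 /not_implyP[Dx1 /not_implyP[Vx1 /eqP xk1]]].
have [d d0 [x2 [Dx2 Vx2 xk2]]] := refl _ Dx1 Vx1.
pose E s t := exists x, [/\ D x, V x, s = (A *m x - b) k 0 &
   F x + dot w (A *m x - b) - c <= t].
have Ex x : D x -> V x -> E ((A *m x - b) k 0) (F x + dot w (A *m x - b) - c).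
  by move=> Dx Vx; exists x.
have sgn : (A *m x1 - b) k 0 * (A *m x2 - b) k 0 < 0.
  by rewrite xk2 mulrCA -expr2 pmulr_llt0 ?oppr_lt0 // exprn_even_gt0.
have [||||l hl] := @scalar_multiplier _ E.
- move=> s t s' t' a [u [Du Vu -> Fu]] [v [Dv Vv -> Fv]] a01.
  have [Dz Fz] := cF _ _ _ Du Dv a01.
  have /andP[a0 a1] := a01; exists (a *: u + (1 - a) *: v); split => //.
  - exact: Vcomb.
  - by rewrite affine_comb !mxE.
  rewrite affine_comb !dotDr !dotZr.
  have := ler_wpM2l a0 Fu; have := @ler_wpM2l _ (1 - a) (_ : 0 <= 1 - a) _ _ Fv.
  by rewrite subr_ge0 => /(_ a1); lra.
- by move=> t [u [Du Vu /esym u0 Fu]]; apply: le_trans Fu; rewrite subr_ge0; exact: hk.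
- have [h|h] := ltP ((A *m x1 - b) k 0) 0.
    by exists ((A *m x1 - b) k 0), (F x1 + dot w (A *m x1 - b) - c); split => //; exact: Ex.
  exists ((A *m x2 - b) k 0), (F x2 + dot w (A *m x2 - b) - c); split; first exact: Ex.
  by rewrite xk2 mulNr oppr_lt0 mulr_gt0 // lt_neqAle eq_sym xk1.
- have [h|h] := ltP 0 ((A *m x1 - b) k 0).
    by exists ((A *m x1 - b) k 0), (F x1 + dot w (A *m x1 - b) - c); split => //; exact: Ex.
  exists ((A *m x2 - b) k 0), (F x2 + dot w (A *m x2 - b) - c); split; first exact: Ex.
  by rewrite xk2 mulNr oppr_gt0 pmulr_rlt0 // lt_neqAle xk1.
(* The scalar multiplier of equation [k] is added to the [k]-th coordinate. *)
exists (w + l *: delta_mx k 0) => x Dx Vx.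
have := hl _ _ (Ex x Dx Vx).
rewrite dotDl dotZl.
have -> : dot (delta_mx k 0) (A *m x - b) = (A *m x - b) k 0.
  rewrite dotE (bigD1 k) //= big1 ?addr0 => [|i ik]; first by rewrite mxE !eqxx mul1r.
  by rewrite mxE (negbTE ik) mul0r.
lra.
Qed.

(** * The x-step is the projection onto the feasible set *)

(** A row v in the kernel satisfies |A^T v^T|^2 + d |v|^2 = 0, and either alternative then forces v
    = 0. *)
Lemma gram_unitmx (R : realType) (m n : nat) (A : 'M[R]_(m, n)) (d : R) :
  0 <= d -> row_free A \/ 0 < d -> A *m A^T + d%:M \in unitmx.
Proof.
move=> d0 fd; rewrite -row_free_unit; apply: inj_row_free => v.
rewrite mulmxDr mul_mx_scalar => vM.
have : dot (A^T *m v^T) (A^T *m v^T) + d * dot v^T v^T = 0.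
  rewrite dot_mull -dotZr -dotDr trmxK.
  have -> : A *m (A^T *m v^T) + d *: v^T = (v *m (A *m A^T) + d *: v)^T.
    by rewrite linearD linearZ /= !trmx_mul trmxK mulmxA.
  by rewrite vM trmx0 /dot mulmx0 mxE.
have h1 := dot_ge0 (A^T *m v^T); have h2 := dot_ge0 v^T => h.
have h3 : 0 <= d * dot v^T v^T by rewrite mulr_ge0.
case: fd => [fA|dp].
  have /dot_eq0 : dot (A^T *m v^T) (A^T *m v^T) = 0 by lra.
  rewrite -trmx_mul => /(congr1 trmx); rewrite trmxK trmx0 => /eqP.
  by rewrite mulmx_free_eq0 // => /eqP.
have /eqP : d * dot v^T v^T = 0 by lra.
rewrite mulf_eq0 gt_eqF //= => /eqP/dot_eq0 /(congr1 trmx).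
by rewrite trmxK trmx0.
Qed.

(* The optimality conditions of the projection of [z] onto the feasible set
   exhibit the root, so that no monotonicity in [t] is needed. *)
Lemma tau_spec (R : realType) (m n : nat) (A : 'M[R]_(m, n)) (b : 'cV[R]_m)
    (eps : R) (y z : 'cV[R]_n) :
  0 < eps -> enorm (A *m y - b) < eps -> eps < enorm (A *m z - b) ->
  let t := tau A b eps z in
  0 < t /\ 1 = t * enorm (invmx (A *m A^T + (eps * t)%:M) *m (A *m z - b)).
Proof.
move=> e0 ye ze.
suff ex : exists t : R, 0 < t /\
    1 = t * enorm (invmx (A *m A^T + (eps * t)%:M) *m (A *m z - b)).
  exact: (xgetPex 0 ex).
(* Projecting [z] is treated as the proximal problem of the zero function restricted to the feasible
   set, so that [closed_fun_prox] applies. *)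
have c0 : closed_fun (fun _ : 'cV[R]_n => 0 : \bar R)%E.
  rewrite /closed_fun /=.
  apply: (@preimage_closed _ _ (fun p : 'cV[R]_n * R => p.2) [set t : R | 0 <= t]).
    by move=> [p1 p2] _; apply: cvg_snd.
  exact: closed_ge.
have [p [pe minp]] : argmin (feasible A b eps)
    (fun u => (1%:E * 0 + (2^-1 * enorm (u - z) ^+ 2)%R%:E)%E) !=set0.
  apply: (@argmin_nonempty _ _ _ _ y (enorm (y - z) + `|z|)).
  - exact: closed_fun_prox.
  - by move=> u; rewrite mule0 add0e ltNyr.
  - exact: feasible_closed.
  - exact: ltW.
  - by rewrite mule0 add0e ltry.
  move=> u _; rewrite mule0 !add0e lee_fin ler_pM2l ?invr_gt0 //.
  rewrite ler_sqr ?nnegrE ?enorm_ge0 // => uy.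
  rewrite -[u in `|u|](subrK z); apply: le_trans (ler_normD _ _) _.
  by rewrite lerD2r; apply: le_trans uy; exact: norm_le_enorm.
have minq u : enorm (A *m u - b) <= eps ->
    2^-1 * dot (p - z) (p - z) <= 2^-1 * dot (u - z) (u - z).
  by move=> /minp; rewrite mule0 !add0e lee_fin !enorm_sqr.
have cq : convex_on setT (fun u => 2^-1 * dot (u - z) (u - z)).
  move=> u v t _ _ t01; split=> //.
  have := affine_comb 1%:M z u v t; rewrite !mul1mx => ->.
  by have := dot_convex (u - z) (v - z) t01; lra.
have [l [l0 lg hl]] := kkt_ball e0 cq (I : setT y) ye (I : setT p) pe (fun u _ => @minq u).
pose w := (2 * l) *: (A *m p - b).
(* By [hl], [p] minimizes the half squared distance to [z] plus the linear term <w, Au> over the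
   whole space. The vector v is the gradient there, and testing the first-order condition at p - v
   gives -|v|^2 >= 0. *)
have zp : z - p = A^T *m w.
  apply/subr0_eq/eqP; rewrite -oppr_eq0; apply/eqP.
  set v := - _; apply: dot_eq0; apply/le_anti; rewrite dot_ge0 andbT.
  have caf : convex_on setT (fun u => dot w (A *m u)).
    move=> u u' t _ _ _; split => //.
    by rewrite mulmxDr -!scalemxAr !dot_lin; lra.
  have := @fermat_quadratic _ _ _ 1%:M z _ _ 2^-1 p (p - v) caf I I.
  rewrite !mul1mx mulfV ?pnatr_eq0 // mul1r => /(_ _)/wrap[].
    move=> u _; rewrite !mul1mx; have := hl u I.
    by rewrite mulmxBr /w !dot_lin; lra.
  have -> : p - v - p = - v by rewrite addrAC subrr add0r.
  rewrite mulmxBr dotDr dotNr (dotC w (A *m v)) dot_mull dotNr.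
  have -> : v = A^T *m w - (z - p) by rewrite /v opprB.
  rewrite -[p - z]opprB dotNl; move: (z - p) (A^T *m w) => r s.
  rewrite !dot_lin (dotC s r); lra.
have lp : 0 < l.
  rewrite lt_neqAle l0 andbT eq_sym; apply/eqP => l00; move: zp.
  rewrite /w l00 mulr0 scale0r mulmx0 => /subr0_eq zp.
  by move: ze; rewrite zp ltNge => /negP; apply.
have rr : dot (A *m p - b) (A *m p - b) = eps ^+ 2.
  by move/eqP: lg; rewrite mulf_eq0 gt_eqF //= subr_eq0 => /eqP.
have re : enorm (A *m p - b) = eps by exact: enorm_eq (ltW e0) rr.
(* The inverse matrix will send [A *m z - b] to [w], whose norm is 2 l eps; the root must be the
   inverse of this norm. *)
exists (2 * l * eps)^-1; split; first by rewrite invr_gt0 !mulr_gt0.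
have et : eps * (2 * l * eps)^-1 = (2 * l)^-1.
  by rewrite invfM mulrCA mulfV ?mulr1 // gt_eqF.
rewrite et.
have U : A *m A^T + ((2 * l)^-1)%:M \in unitmx.
  by apply: gram_unitmx; [|right]; rewrite ?invr_ge0 ?invr_gt0 ?mulr_ge0 ?mulr_gt0.
have -> : A *m z - b = (A *m A^T + ((2 * l)^-1)%:M) *m w.
  rewrite mulmxDl -mulmxA -zp mul_scalar_mx /w scalerA mulVf ?scale1r ?mulf_neq0 ?gt_eqF //.
  by rewrite mulmxBr addrA subrK.
rewrite mulKmx // /w enormZ re ger0_norm ?mulr_ge0 // mulVf // gt_eqF //.
by rewrite !mulr_gt0.
Qed.

(** Outside the feasible set the new residual is d w, with d |w| = eps. The inner product equals <w,
    Ac - b> - d |w|^2, which Cauchy-Schwarz bounds by |w| eps - |w| eps = 0. *)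
Lemma xstep_spec (R : realType) (m n : nat) (A : 'M[R]_(m, n)) (b : 'cV[R]_m)
    (eps : R) (y z : 'cV[R]_n) :
  0 <= eps -> row_free A \/ 0 < eps -> (0 < eps -> enorm (A *m y - b) < eps) ->
  feasible A b eps (xstep A b eps z) /\
  forall c, feasible A b eps c ->
    dot (z - xstep A b eps z) (c - xstep A b eps z) <= 0.
Proof.
move=> e0 Ae ye; rewrite /xstep; case: ifPn => [zC|].
  by split => // c _; rewrite subrr -(scale0r (0 : 'cV[R]_n)) dotZl mul0r.
rewrite -ltNge => ze.
set d := eps * _; set w := invmx _ *m _.
(* For eps = 0 the value of [tau] is irrelevant, even if it is the default of [xget]: d is 0 and
   full row rank gives invertibility. *)
have [d0 dp wn] : [/\ 0 <= d, row_free A \/ 0 < d & d * enorm w = eps].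
  have [ep|ep] := ltP 0 eps.
    have [tp t1] := tau_spec ep (ye ep) ze.
    split; first by rewrite mulr_ge0 // ltW.
      by right; rewrite mulr_gt0.
    by rewrite /d /w -mulrA -t1 mulr1.
  have ez : eps = 0 by apply/le_anti/andP.
  have -> : d = 0 by rewrite /d ez mul0r.
  by split=> //; [case: Ae; [left|rewrite ez ltxx]|rewrite mul0r].
have Mw : A *m (A^T *m w) + d *: w = A *m z - b.
  by rewrite mulmxA -mul_scalar_mx -mulmxDl /w mulKVmx // gram_unitmx.
have res : A *m (z - A^T *m w) - b = d *: w.
  by rewrite mulmxBr addrAC -Mw addrAC subrr add0r.
split=> [|c cC]; first by rewrite /feasible /= res enormZ ger0_norm // wn.
have -> : z - (z - A^T *m w) = A^T *m w by rewrite opprB addrC subrK.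
rewrite dot_mull trmxK.
have -> : A *m (c - (z - A^T *m w)) = (A *m c - b) - d *: w.
  by rewrite -res mulmxBr opprB addrA subrK.
rewrite dotDr dotNr dotZr subr_le0.
apply: le_trans (dot_cauchy _ _) _; rewrite -enorm_sqr expr2 mulrCA.
by rewrite ler_wpM2l ?enorm_ge0 // wn.
Qed.

(** * Firm nonexpansiveness and convergence of Fejer monotone sequences *)

Lemma cvg_dot (R : realType) (n : nat) (u : nat -> 'cV[R]_n) (l : 'cV[R]_n) :
  (forall e, 0 < e -> exists N, forall k, (N <= k)%N -> dot (u k - l) (u k - l) < e) ->
  u @ \oo --> l.
Proof.
move=> h; apply/cvgrPdist_lt => e e0.
have [N hN] := h (e ^+ 2) (exprn_gt0 2 e0).
exists N => // k /= /hN; rewrite -(enorm_lt _ (ltW e0)) -enormN opprB.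
exact: le_lt_trans (norm_le_enorm _).
Qed.

(** Here e, a, c stand for the differences of the z, x and y components of two trajectories. The
    right side minus the left side is exactly twice the sum of the two hypotheses. *)
Lemma dr_firm (R : realType) (n : nat) (e a c : 'cV[R]_n) :
  0 <= dot (e - a) a -> 0 <= dot (2 *: a - e - c) c ->
  dot (e + (c - a)) (e + (c - a)) + dot (c - a) (c - a) <= dot e e.
Proof.
rewrite !dot_lin (dotC c a) (dotC c e) (dotC a e); lra.
Qed.

(** [G z0 x0 y0] relates a point to its two half-steps, and fixed points are those with x0 = y0.
    Distances to a fixed point decrease, so the iterates have a cluster point and their increments
    tend to 0. Firmness makes the cluster point fixed; the distance to it also decreases and gets
    arbitrarily small, so it tends to 0. *)
Lemma fejer_cvg (R : realType) (n : nat)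
    (G : 'cV[R]_n -> 'cV[R]_n -> 'cV[R]_n -> Prop) (z x y : nat -> 'cV[R]_n) :
  (forall z0, exists x0 y0, G z0 x0 y0) ->
  (forall z0 x0 y0 z1 x1 y1, G z0 x0 y0 -> G z1 x1 y1 ->
     dot (z0 + (y0 - x0) - (z1 + (y1 - x1))) (z0 + (y0 - x0) - (z1 + (y1 - x1))) +
     dot ((y0 - x0) - (y1 - x1)) ((y0 - x0) - (y1 - x1)) <= dot (z0 - z1) (z0 - z1)) ->
  (forall z0 x0 y0 z1 x1 y1, G z0 x0 y0 -> G z1 x1 y1 ->
     dot (x0 - x1) (x0 - x1) <= dot (z0 - z1) (z0 - z1)) ->
  (exists zf xf, G zf xf xf) ->
  (forall k, G (z k) (x k) (y k)) -> (forall k, z k.+1 = z k + (y k - x k)) ->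
  exists zb xb, [/\ G zb xb xb, z @ \oo --> zb & x @ \oo --> xb].
Proof.
move=> totG firm lip [zf [xf Gf]] Gk zS.
have fejer p q k : G p q q ->
    dot (z k.+1 - p) (z k.+1 - p) + dot (y k - x k) (y k - x k) <= dot (z k - p) (z k - p).
  by move=> Gp; have := firm _ _ _ _ _ _ (Gk k) Gp; rewrite subrr addr0 subr0 -zS.
have mono p q N k : G p q q -> (N <= k)%N ->
    dot (z k - p) (z k - p) <= dot (z N - p) (z N - p).
  move=> Gp; elim: k => [|k IH]; first by rewrite leqn0 => /eqP ->.
  rewrite leq_eqVlt ltnS => /orP[/eqP -> //|/IH].
  by have := fejer _ _ k Gp; have := dot_ge0 (y k - x k); lra.
pose d k := dot (z k - zf) (z k - zf).
have hd : has_inf (range d).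
  by split; [exists (d 0%N), 0%N|exists 0 => _ [k _ <-]; exact: dot_ge0].
have small e : 0 < e -> exists N, forall k, (N <= k)%N -> dot (y k - x k) (y k - x k) < e.
  move=> e0; have [_ [N _ <-] dN] := inf_adherent e0 hd; exists N => k Nk.
  have : inf (range d) <= d k.+1 by apply: ge_inf; [exact: hd.2|exists k.+1].
  by have := mono _ _ _ _ Gf Nk; have := fejer _ _ k Gf; rewrite -!/(d _); lra.
pose K := [set u : 'cV[R]_n | enorm (1%:M *m u - zf) <= enorm (z 0%N - zf)].
have Kc : compact K.
  apply: (@bounded_closed_compact_cV _ _ _ (enorm (z 0%N - zf) + `|zf|)).
    exact: feasible_closed.
  move=> u; rewrite /K /= mul1mx => uK.
  rewrite -[u in `|u|](subrK zf); apply: le_trans (ler_normD _ _) _.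
  by rewrite lerD2r; apply: le_trans uK; exact: norm_le_enorm.
have [p [_ clp]] : (K `&` cluster (z @ \oo)) !=set0.
  apply: Kc; exists 0%N => // k _; rewrite /K /= mul1mx enorm_le ?enorm_ge0 // enorm_sqr.
  exact: (mono _ _ _ _ Gf).
have near_p e N : 0 < e -> exists2 k, (N <= k)%N & dot (z k - p) (z k - p) < e.
  move=> e0.
  have nB : nbhs p [set q | dot (1%:M *m q - p) (1%:M *m q - p) < e].
    have cd : continuous (fun q : 'cV[R]_n => dot (1%:M *m q - p) (1%:M *m q - p)).
      by apply: dot_continuous; exact: affine_continuous.
    apply: (cd p [set t | t < e]); apply: open_nbhs_nbhs; split; first exact: open_lt.
    by rewrite /= mul1mx subrr -(scale0r 0) dotZl mul0r.
  have nA : (z @ \oo) [set z k | k in [set k | (N <= k)%N]].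
    by exists N => // k /= Nk; exists k.
  have [_ [[k /= Nk <-]]] := clp _ _ nA nB.
  by rewrite /= mul1mx; exists k.
have [xp [yp Gp]] := totG p.
have yx : yp = xp.
  apply/subr0_eq/dot_eq0/le_anti; rewrite dot_ge0 andbT.
  rewrite leNgt; apply/negP; set w := yp - xp => w0.
  (* Let v be an increment such that v and z_k - p are both shorter than |w|/2. Then |v - w| > |w|/2
     > |z_k - p|, against firmness. *)
  have e0 : 0 < dot w w / 4 by rewrite divr_gt0.
  have [N hN] := small _ e0; have [k Nk kp] := near_p _ N e0.
  have := firm _ _ _ _ _ _ (Gk k) Gp; have := hN k Nk.
  have := dot_ge0 (z k + (y k - x k) - (p + (yp - xp))); rewrite -/w.
  clearbody w; move: (dot (z k + _ - _) _) => T; move: kp; move: (dot (z k - p) _) => S.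
  move: (y k - x k) => v; have := dot_ge0 (2 *: v - w).
  rewrite !dot_lin (dotC w v); lra.
rewrite yx in Gp.
have zsmall e : 0 < e -> exists N, forall k, (N <= k)%N -> dot (z k - p) (z k - p) < e.
  move=> e0; have [N _ hN] := near_p e 0%N e0; exists N => k Nk.
  exact: le_lt_trans (mono _ _ _ _ Gp Nk) hN.
exists p, xp; split=> //; first exact: cvg_dot.
apply: cvg_dot => e /zsmall[N hN]; exists N => k Nk.
exact: le_lt_trans (lip _ _ _ _ _ _ (Gk k) Gp) (hN k Nk).
Qed.

(** * Solutions, their normal vectors, and the convergence theorem *)

Lemma relint_reflect (R : realType) (n : nat) (S : set 'cV[R]_n) (y x : 'cV[R]_n) :
  relint S y -> S x -> exists2 d, 0 < d & S (y + d *: (y - x)).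
Proof.
move=> [Sy [e e0 he]] Sx.
have a0 : 0 < enorm (y - x) + 1 by rewrite ltr_wpDl // enorm_ge0.
(* Adding 1 keeps the denominator positive when x = y and makes the displacement shorter than e. *)
exists (e / (enorm (y - x) + 1)); first by rewrite divr_gt0.
set d := e / _; have d0 : 0 < d by rewrite divr_gt0.
apply: he.
  rewrite reflection_comb.
  by move=> T [affT ST]; apply: affT; exact: ST.
rewrite addrC addKr enormZ gtr0_norm // /d mulrAC ltr_pdivrMr // ltr_pM2l //.
by rewrite ltrDl.
Qed.

Lemma slater_feasible (R : realType) (m n : nat) (A : 'M[R]_(m, n)) (b : 'cV[R]_m)
    (eps : R) (y : 'cV[R]_n) : 0 <= eps ->
  (eps = 0 -> A *m y = b) -> (0 < eps -> enorm (A *m y - b) < eps) ->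
  feasible A b eps y.
Proof.
move=> e0 y0 ye; have [/ye/ltW //|ep] := ltP 0 eps.
by rewrite /feasible /= y0 ?subrr ?enorm0 //; apply/le_anti/andP.
Qed.

Lemma normal_multiplier (R : realType) (m n : nat) (A : 'M[R]_(m, n)) (b : 'cV[R]_m)
    (eps : R) (f : 'cV[R]_n -> \bar R) (y p : 'cV[R]_n) :
  0 <= eps -> convex_fun f -> proper_fun f -> relint (edom f) y ->
  (eps = 0 -> A *m y = b) -> (0 < eps -> enorm (A *m y - b) < eps) ->
  argmin (feasible A b eps) f p ->
  exists v, (forall c, feasible A b eps c -> dot v (c - p) <= 0) /\
    forall u, edom f u -> fine (f p) <= fine (f u) + dot v (u - p).
Proof.
move=> e0 vf pf riy y0 ye [pC minp].
have yC := slater_feasible e0 y0 ye.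
have Dy : edom f y := riy.1.
have Dp : edom f p by apply: le_lt_trans (minp _ yC) Dy.
have minF u : edom f u -> feasible A b eps u -> fine (f p) <= fine (f u).
  by move=> Du uC; rewrite -lee_fin !edom_fineK // minp.
have cF := convex_on_fine pf vf.
have [ep|ep] := ltP 0 eps.
  have [l [l0 lg hl]] := kkt_ball ep cF Dy (ye ep) Dp pC minF.
  (* Normality combines Cauchy-Schwarz, <Ap - b, Ac - b> <= eps^2, with complementary slackness, l
     |Ap - b|^2 = l eps^2. *)
  exists ((2 * l) *: (A^T *m (A *m p - b))); split.
    move=> c cC; rewrite dotZl dot_mull trmxK.
    have -> : A *m (c - p) = (A *m c - b) - (A *m p - b).
      by rewrite mulmxBr opprB addrA subrK.
    rewrite dotDr dotNr.
    have : dot (A *m p - b) (A *m c - b) <= eps * eps.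
      by apply: le_trans (dot_cauchy _ _) _; apply: ler_pM; rewrite ?enorm_ge0.
    move=> /(ler_wpM2l l0); move: lg; rewrite expr2; lra.
  by move=> u /hl; rewrite dotZl dot_mull trmxK /=; lra.
have ez : eps = 0 by apply/le_anti/andP.
have feq c : feasible A b eps c <-> A *m c = b.
  rewrite /feasible /= ez; split => [h|->]; last by rewrite subrr enorm0.
  apply/subr0_eq/dot_eq0; rewrite -enorm_sqr.
  by have -> : enorm (A *m c - b) = 0; [apply/le_anti; rewrite h enorm_ge0|rewrite expr0n].
have [w hw] := affine_multiplier cF Dy (y0 ez) (fun x => relint_reflect riy)
  (fun x Dx Ax => minF x Dx ((feq x).2 Ax)).
(* A vector in the range of A^T is orthogonal to all differences of solutions of A c = b. *)
exists (A^T *m w); split => [c /feq Ac|u Du].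
  by rewrite dot_mull trmxK mulmxBr Ac ((feq p).1 pC) subrr -(scale0r 0) dotZr mul0r.
by rewrite dot_mull trmxK mulmxBr ((feq p).1 pC); exact: hw.
Qed.

Lemma solution_exists (R : realType) (m n : nat) (A : 'M[R]_(m, n)) (b : 'cV[R]_m)
    (eps : R) (f : 'cV[R]_n -> \bar R) (y : 'cV[R]_n) :
  closed_fun f -> proper_fun f -> edom f y -> feasible A b eps y ->
  coercive f \/ bounded_set (feasible A b eps) ->
  argmin (feasible A b eps) f !=set0.
Proof.
move=> cf pf Dy yC cb.
have [r hr] : exists r, forall x, feasible A b eps x -> (f x <= f y)%E -> `|x| <= r.
  case: cb => [cof|[M [_ hM]]]; last first.
    by exists (M + 1) => x xC _; apply: hM xC; rewrite ltrDl.
  have [r hr] := cof (fine (f y)); exists r => x _ xy.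
  apply: le_trans (norm_le_enorm _) _; rewrite leNgt; apply/negP => /hr.
  by rewrite edom_fineK // ltNge xy.
apply: (@argmin_nonempty _ _ f (feasible A b eps) y r) => //; first exact: pf.1.
exact: feasible_closed.
Qed.

Theorem theorem1 (R : realType) (m n : nat) (f : 'cV[R]_n -> \bar R)
  (A : 'M[R]_(m, n)) (b : 'cV[R]_m) (eps : R) (heps : 0 <= eps)
  (C1 : [/\ closed_fun f, convex_fun f & proper_fun f])
  (C2 : row_free A \/ 0 < eps)
  (C3 : exists y : 'cV[R]_n,
     (eps = 0 -> A *m y = b) /\ (0 < eps -> enorm (A *m y - b) < eps))
  (C4 : coercive f \/ bounded_set (feasible A b eps))
  (C5 : exists2 y : 'cV[R]_n, relint (edom f) y &
     (eps = 0 -> A *m y = b) /\ (0 < eps -> enorm (A *m y - b) < eps))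
  (z1 : 'cV[R]_n) (alpha : R) (halpha : 0 < alpha)
  (x z : nat -> 'cV[R]_n)
  (hz1 : z 1%N = z1)
  (hx : forall k : nat, (1 <= k)%N -> x k = xstep A b eps (z k))
  (hz : forall k : nat, (1 <= k)%N ->
     z k.+1 = z k + prox alpha f (2 *: x k - z k) - x k) :
  (exists xs zs : 'cV[R]_n,
     [/\ x @ \oo --> xs, z @ \oo --> zs & argmin (feasible A b eps) f xs]) /\
  (forall k : nat, (1 <= k)%N -> enorm (A *m x k - b) <= eps).
Proof.
have [cf vf pf] := C1; have [y riy [y0 ye]] := C5.
have P w := xstep_spec w heps C2 ye.
split; last by move=> k /hx ->; case: (P (z k)).
have yC := slater_feasible heps y0 ye.
have [p minp] := solution_exists cf pf riy.1 yC C4.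
have [v [vC vf']] := normal_multiplier heps vf pf riy y0 ye minp.
have Dp : edom f p by apply: le_lt_trans (minp.2 _ yC) riy.1.
(* One iteration: x is the projection of z, and y the proximal point of the reflection 2x - z. In
   this variational form a fixed point can be checked directly from [v]. *)
pose G z x y := [/\ feasible A b eps x,
  forall c, feasible A b eps c -> dot (z - x) (c - x) <= 0, edom f y &
  forall u, edom f u -> alpha * fine (f y) + dot (2 *: x - z - y) (u - y)
    <= alpha * fine (f u)].
have Gtot w : G w (xstep A b eps w) (prox alpha f (2 *: xstep A b eps w - w)).
  by have [? ?] := P w; have [? ?] := prox_spec (2 *: xstep A b eps w - w) halpha cf vf pf.
have lip z0 x0 y0' z1' x1 y1 : G z0 x0 y0' -> G z1' x1 y1 ->
    0 <= dot ((z0 - z1') - (x0 - x1)) (x0 - x1).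
  move=> [C0 N0 _ _] [C1' N1 _ _]; have := N0 _ C1'; have := N1 _ C0.
  rewrite !dot_lin; lra.
(* The sequences are shifted by one, since nothing is assumed about index 0. *)
have [] := @fejer_cvg R n G (fun k => z k.+1) (fun k => x k.+1)
    (fun k => prox alpha f (2 *: x k.+1 - z k.+1)).
- by move=> w; do 2!eexists; exact: Gtot.
- move=> z0 x0 y0' z1' x1 y1 G0 G1; have h := lip _ _ _ _ _ _ G0 G1.
  have [_ _ D0 S0] := G0; have [_ _ D1 S1] := G1.
  have : 0 <= dot (2 *: (x0 - x1) - (z0 - z1') - (y0' - y1)) (y0' - y1).
    by have := S0 _ D1; have := S1 _ D0; rewrite !dot_lin; lra.
  move=> /(dr_firm h).
  have -> : y0' - y1 - (x0 - x1) = y0' - x0 - (y1 - x1).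
    by apply/colP => i; rewrite !mxE; ring.
  have -> // : z0 - z1' + (y0' - x0 - (y1 - x1)) = z0 + (y0' - x0) - (z1' + (y1 - x1)).
  by apply/colP => i; rewrite !mxE; ring.
- move=> z0 x0 y0' z1' x1 y1 G0 G1; have := lip _ _ _ _ _ _ G0 G1.
  move: (z0 - z1') (x0 - x1) => e a; have := dot_ge0 (e - a).
  rewrite !dot_lin (dotC a e); lra.
(* At z = p + alpha v, x = p, the vector z - x = alpha v is normal to the feasible set, and (2x - z)
   - p = -alpha v is a subgradient of alpha f at p. *)
- exists (p + alpha *: v), p; split=> //; first exact: minp.1.
    by move=> c /vC; rewrite addrAC subrr add0r dotZl pmulr_rle0.
  move=> u /vf'; rewrite -(ler_pM2l halpha) => h.
  have -> : 2 *: p - (p + alpha *: v) - p = - (alpha *: v).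
    by apply/colP => i; rewrite !mxE; ring.
  by move: h; rewrite dotNl dotZl; lra.
- by move=> k; rewrite hx.
- by move=> k; rewrite hz // addrA.
move=> zb [xb [[xbC N Dxb S] zcv xcv]]; exists xb, zb; split.
- by rewrite -cvg_shiftS.
- by rewrite -cvg_shiftS.
split=> // c cC; have [Dc|] := boolP (f c < +oo)%E; last first.
  by rewrite -leNgt leye_eq => /eqP ->; rewrite leey.
rewrite -(edom_fineK pf Dxb) -(edom_fineK pf Dc) lee_fin -(ler_pM2l halpha).
(* At a fixed point both inequalities involve <zb - xb, c - xb>, which is at most 0 by [N]; [S] then
   yields alpha f(xb) <= alpha f(c). *)
have := S _ Dc; have := N _ cC.
have -> : 2 *: xb - zb - xb = - (zb - xb) by apply/colP => i; rewrite !mxE; ring.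
rewrite dotNl; lra.
Qed.
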